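(* Let $S$ be an arbitrary set, let $\Sigma$ be a $\sigma$-algebra over $S$, and let $\mathrm{M}$ be the set of all nonnegative real-valued (hence finite) measures on $\Sigma$. Let $k\ge1$ be an integer, let $f_1,\dots,f_k\colon S\to\mathbb{R}$ be $\Sigma$-measurable functions, $\mathbf{f}=(f_1,\dots,f_k)$, and let $C\subseteq\mathbb{R}^k$ be any set. Let $\Lambda\subseteq\mathrm{M}$ be a convex cone such that $\mu_A\in\Lambda$ for all $\mu\in\Lambda$ and $A\in\Sigma$. Let $g\colon S\to\mathbb{R}$ be a $\Sigma$-measurable function such that the integral $\int_S g\,d\mu$ exists in $[-\infty,\infty]$ for each $\mu\in\Lambda_{\mathbf{f},C}$. Take any $\mu\in\operatorname{ex}\Lambda_{\mathbf{f},C}$. Then: (i) there is a measure $\tilde\mu$ such that $$\tilde\mu\in\Delta_{\mathbf{f}}^{(k)}\cap\mathrm{M}_{\mathbf{f},C},\qquad \int_S\mathbf{f}\,d\tilde\mu=\int_S\mathbf{f}\,d\mu,\qquad \int_S g\,d\tilde\mu=\int_S g\,d\mu;$$ (ii) if, in addition, $\Delta_{\mathbf{f}}^{(k)}\subseteq\Lambda$, then it follows that $\tilde\mu\in\Delta_{\mathbf{f}}^{(k)}\cap\Lambda_{\mathbf{f},C}$. Moreover, in these statements one can replace $\Delta_{\mathbf{f}}^{(k)}$ by $\Delta^{(k)}$ throughout (including in the additional hypothesis of (ii)).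
   Context: For $\mu\in\mathrm{M}$ and $A\in\Sigma$, the truncation $\mu_A\in\mathrm{M}$ is defined by $\mu_A(B)=\mu(A\cap B)$ for $B\in\Sigma$. One writes $\mathbf{f}\in L^1(\mu)$ if every $f_j$ is $\mu$-integrable, and $\int_S\mathbf{f}\,d\mu=(\int_S f_1\,d\mu,\dots,\int_S f_k\,d\mu)$. The moment sets are $\mathrm{M}_{\mathbf{f},C}=\{\mu\in\mathrm{M}\colon \mathbf{f}\in L^1(\mu),\ \int_S\mathbf{f}\,d\mu\in C\}$ and $\Lambda_{\mathbf{f},C}=\Lambda\cap\mathrm{M}_{\mathbf{f},C}$. For a (not necessarily convex) set $\mathrm{K}\subseteq\mathrm{M}$, $\operatorname{ex}\mathrm{K}$ is the set of all extreme points of $\mathrm{K}$: $\mu\in\operatorname{ex}\mathrm{K}$ iff $\mu\in\mathrm{K}$ and for any $t\in(0,1)$ and $\nu_0,\nu_1\in\mathrm{K}$ with $(1-t)\nu_0+t\nu_1=\mu$ one has $\nu_0=\nu_1$. For $s\in S$, $\delta_s$ is the Dirac probability measure on $\Sigma$: $\delta_s(A)=1$ if $s\in A$ and $\delta_s(A)=0$ otherwise. The set $\Delta_{\mathbf{f}}^{(k)}$ consists of all measures $\sum_{i=1}^m a_i\delta_{s_i}$ with $m\in\{0,1,\dots,k\}$, $(a_1,\dots,a_m)\in(0,\infty)^m$, $(s_1,\dots,s_m)\in S^m$ such that the vectors $\mathbf{f}(s_1),\dots,\mathbf{f}(s_m)$ are linearly independent; for $m=0$ the sum is the zero measure and the conditions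 are regarded as trivially satisfied, so $0\in\Delta_{\mathbf{f}}^{(k)}$. The set $\Delta^{(k)}$ consists of all measures $\sum_{i=1}^k a_i\delta_{s_i}$ with $(a_1,\dots,a_k)\in[0,\infty)^k$ and $(s_1,\dots,s_k)\in S^k$. *)

(* Defs.v *)
From HB Require Import structures.
From mathcomp Require Import all_boot all_order all_algebra.
From mathcomp Require Import all_classical all_reals all_analysis.
Import Order.TTheory GRing.Theory Num.Theory.
Import numFieldNormedType.Exports.

Set Implicit Arguments.
Unset Strict Implicit.
Unset Printing Implicit Defensive.

Local Open Scope classical_set_scope.
Local Open Scope ring_scope.

Section MomentSets.
Context {d : measure_display} {S : measurableType d} {R : realType}.

(* A library measure is a function on all subsets of S of which only the values
   on measurable sets matter. Hence measures on the sigma-algebra are compared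
   with [meas_eq] rather than [=], and a set of measures on the sigma-algebra is
   a set of library measures that is saturated for [meas_eq]. *)
Definition meas_eq (mu nu : {measure set S -> \bar R}) : Prop :=
  forall A, measurable A -> mu A = nu A.

Definition meas_saturated (K : set {measure set S -> \bar R}) : Prop :=
  forall mu nu, meas_eq mu nu -> K mu -> K nu.

Definition finite_measures : set {measure set S -> \bar R} :=
  [set mu | fin_num_fun mu].

Definition convex_cone (L : set {measure set S -> \bar R}) : Prop :=
  (forall (a : {nonneg R}) mu, L mu -> L (mscale a mu)) /\
  (forall mu nu, L mu -> L nu -> L (measure_add mu nu)).

(* [mrestr mu mA] is the measure B |-> mu (B `&` A). *)
Definition truncation_closed (L : set {measure set S -> \bar R}) : Prop :=
  forall mu A (mA : measurable A), L mu -> L (mrestr mu mA).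

Definition extreme_points (K : set {measure set S -> \bar R}) :
    set {measure set S -> \bar R} :=
  [set mu | K mu /\
    forall (t : R) (nu0 nu1 : {measure set S -> \bar R}),
      0 < t -> t < 1 -> K nu0 -> K nu1 ->
      (forall A, measurable A ->
        ((1 - t)%:E * nu0 A + t%:E * nu1 A)%E = mu A) ->
      meas_eq nu0 nu1].

(* The Lebesgue integral of g is defined in [-oo, +oo], i.e. is not of the form
   +oo - +oo (the library integral is total). *)
Definition integral_exists (mu : {measure set S -> \bar R}) (g : S -> R) : Prop :=
  (\int[mu]_x ((EFin \o g)^\+ x) < +oo)%E \/
  (\int[mu]_x ((EFin \o g)^\- x) < +oo)%E.

Definition vec {k : nat} (f : 'I_k -> S -> R) (s : S) : 'rV[R]_k :=
  \row_j f j s.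

Definition vintegral {k : nat} (mu : {measure set S -> \bar R})
    (f : 'I_k -> S -> R) : 'rV[R]_k :=
  \row_j \int[mu]_x f j x.

Definition moment_set {k : nat} (f : 'I_k -> S -> R) (C : set 'rV[R]_k) :
    set {measure set S -> \bar R} :=
  [set mu | [/\ finite_measures mu,
    forall j, mu.-integrable setT (EFin \o f j) &
    C (vintegral mu f)]].

Definition is_dirac_comb {m : nat} (a : 'I_m -> R) (s : 'I_m -> S)
    (mu : {measure set S -> \bar R}) : Prop :=
  forall A, measurable A -> mu A = (\sum_(i < m) (a i)%:E * \d_(s i) A)%E.

Definition Delta_indep {k : nat} (f : 'I_k -> S -> R) :
    set {measure set S -> \bar R} :=
  [set mu | exists m (a : 'I_m -> R) (s : 'I_m -> S),
    [/\ (m <= k)%N, forall i, 0 < a i,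
        free [seq vec f (s i) | i <- enum 'I_m] & is_dirac_comb a s mu]].

(* On an empty S this set would be empty for k >= 1;
   measurable types are pointed, so this does not occur. *)
Definition Delta (k : nat) : set {measure set S -> \bar R} :=
  [set mu | exists (a : 'I_k -> R) (s : 'I_k -> S),
    (forall i, 0 <= a i) /\ is_dirac_comb a s mu].

End MomentSets.

(* Main.v *)
(* For a finite measurable partition of S, let v_j be the integral of f over the
   cell A_j. If sum_j c_j v_j = 0, the measures with density 1 +- eps c_j on A_j
   lie in the same moment set and average to mu, so extremality forces c_j = 0
   on every cell of positive measure. Hence at most k cells have positive
   measure, and a partition with the maximal number of them consists of null
   sets and atoms of mu. The f_j and g are almost everywhere constant on an atom,
   so moving the mass of each atom to a suitable point of it preserves all the
   integrals. In particular g is mu-integrable. *)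
Require Import Defs.
From HB Require Import structures.
From mathcomp Require Import all_boot all_order all_algebra.
From mathcomp Require Import all_classical all_reals all_analysis.
From mathcomp Require Import measurable_realfun.
Import Order.TTheory GRing.Theory Num.Theory.
Import numFieldNormedType.Exports.

Local Open Scope classical_set_scope.
Local Open Scope ring_scope.

Set Implicit Arguments.
Unset Strict Implicit.

(** * Integrals under scaling, truncation and finite partitions; functions on atoms *)

Section Integration.
Context {d : measure_display} {S : measurableType d} {R : realType}.
Local Open Scope ereal_scope.

Lemma integral_mscale (mu : {measure set S -> \bar R}) (w : {nonneg R}%R)
    (h : S -> \bar R) : mu.-integrable setT h ->
  (mscale w mu).-integrable setT h /\
  \int[mscale w mu]_x h x = w%:num%:E * \int[mu]_x h x.
Proof.
move=> ih; have /integrableP[mh hoo] := ih; split.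
  apply/integrableP; split => //; rewrite ge0_integral_mscale//; last first.
    exact: measurableT_comp.
  by apply: lte_mul_pinfty => //; rewrite lee_fin.
rewrite [LHS]integralE !ge0_integral_mscale//;
  do ?by [exact: measurable_funeneg|exact: measurable_funepos].
by rewrite -muleBr// -?integralE?integrable_add_def.
Qed.

(** The complement of [A] is null for the truncation, and on measurable subsets of [A] the
    truncation agrees with [mu]. *)
Lemma integral_mrestr (mu : {measure set S -> \bar R}) (A : set S)
    (mA : measurable A) (h : S -> \bar R) : mu.-integrable setT h ->
  (mrestr mu mA).-integrable setT h /\
  \int[mrestr mu mA]_x h x = \int[mu]_(x in A) h x.
Proof.
move=> ih.
have nA : mrestr mu mA (~` A) = 0 by rewrite /mrestr setICl measure0.
have mAC : measurable (~` A) by exact: measurableC.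
have E (u : S -> \bar R) :
    \int[mrestr mu mA]_(x in A) u x = \int[mu]_(x in A) u x.
  by apply: eq_measure_integral => B mB BA; rewrite /= /mrestr setIidl.
have iA : (mrestr mu mA).-integrable A h.
  have /integrableP[mh hoo] : mu.-integrable A h by exact: integrableS ih.
  by apply/integrableP; rewrite E.
have iT : (mrestr mu mA).-integrable setT h.
  have /integrableP[mh _] := ih.
  by apply/(negligible_integrable mAC measurableT mh nA); rewrite setTD setCK.
by rewrite (negligible_integral mAC measurableT iT nA) setTD setCK.
Qed.

(** Finite partitions are encoded as the fibers of a map [phi] into a finite type, which makes
    disjointness and covering automatic; empty cells are allowed. *)
Lemma measure_fibers (mu : {measure set S -> \bar R}) (J : finType)
    (phi : S -> J) (mphi : forall j, measurable (phi @^-1` [set j]))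
    (B : set S) : measurable B ->
  mu B = \sum_(j : J) mu (B `&` phi @^-1` [set j]).
Proof.
move=> mB.
rewrite {1}(_ : B = \bigcup_(j in [set: J]) (B `&` phi @^-1` [set j]));
    last first.
  rewrite -setI_bigcupr -[LHS]setIT; congr (_ `&` _).
  by apply/seteqP; split => // x _; exists (phi x).
rewrite measure_fin_bigcup//.
- rewrite (fsbigE (enum J)) ?enum_uniq//; last by move=> i _; rewrite mem_enum.
  by rewrite big_enum_cond/=; apply: eq_bigl => i; rewrite in_setT.
- exact: finite_finset.
- apply/trivIsetP => i j _ _ ij; apply/seteqP; split => // x.
  by move=> [[_ /= xi] [_ /= xj]]; move/eqP: ij; apply; rewrite -xi.
- by move=> j _; exact: measurableI.
Qed.

(** Each sublevel set of [h] is null or conull in [A]. The constant is the threshold between the two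
    cases, the supremum of the levels [r] for which [h <= r] is null in [A]. *)
Lemma atom_ae_constant (mu : {measure set S -> \bar R}) (A : set S)
    (mA : measurable A) (muA : mu A != 0)
    (atom : forall B, measurable B -> mu (A `&` B) = 0 \/ mu (A `\` B) = 0)
    (h : S -> R) (mh : measurable_fun setT h) :
  exists c, mu (A `&` [set x | h x <> c]) = 0.
Proof.
have mle r : measurable [set x | (h x <= r)%R].
  by rewrite -[X in measurable X]setTI -preimage_itvNyc; exact: mh.
have nle r : mu (A `&` [set x | (h x <= r)%R]) != 0 ->
    mu.-negligible (A `&` [set x | (r < h x)%R]).
  case: (atom _ (mle r)) => [-> /eqP//|+ _] => nA.
  exists (A `\` [set x | (h x <= r)%R]); split => //; first exact: measurableD.
  by move=> x [Ax /= hx]; split => //=; apply/negP; rewrite -ltNge.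
pose E := [set r : R | mu (A `&` [set x | (h x <= r)%R]) = 0].
have Eneg r : E r -> mu.-negligible (A `&` [set x | (h x <= r)%R]).
  by move=> Er; apply/negligibleP => //; exact: measurableI.
(* Countably many null pieces cannot cover [A]. This excludes that no level lies in [E] and that [E]
   is unbounded above, so [sup E] is a genuine supremum. *)
have full (F : nat -> set S) : (forall n, mu.-negligible (A `&` F n)) ->
    A `<=` \bigcup_n F n -> False.
  move=> nF AF; move/eqP: muA; apply; apply: measure_negligible => //.
  apply: negligibleS (negligible_bigcup nF) => x Ax.
  by have [n _ Fx] := AF x Ax; exists n.
have E0 : E !=set0.
  apply: contrapT => /nonemptyPn E0.
  apply: (full (fun n => [set x | (- n%:R < h x)%R])).
    move=> n; apply: nle; apply/eqP => En.
    by have : E (- n%:R)%R by []; rewrite E0.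
  move=> x Ax; exists (Num.truncn `|h x|).+1 => //=.
  by rewrite ltrNl (le_lt_trans (ler_norm _))// normrN Num.Theory.truncnS_gt.
have Eub : has_ubound E.
  apply: contrapT => /has_ubPn nE.
  apply: (full (fun n => [set x | (h x <= n%:R)%R])).
    move=> n; have [r Er nr] := nE n%:R.
    apply: negligibleS (Eneg r Er) => x [Ax /= hx]; split => //=.
    by rewrite (le_trans hx)// ltW.
  move=> x Ax; exists (Num.truncn `|h x|).+1 => //=.
  by rewrite (le_trans (ler_norm _))// ltW// Num.Theory.truncnS_gt.
exists (sup E); apply: measure_negligible.
  apply: measurableI => //; rewrite -[X in measurable X]setTI.
  by apply: (mh measurableT [set~ sup E]); exact: measurableC.
(* Off the value [sup E], [h] is at most [sup E - 1/(n+1)] or above [sup E + 1/(n+1)] for some [n];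
   each of these sets is null in [A]. *)
apply: negligibleS (negligibleU
  (negligible_bigcup (fun n => _ : mu.-negligible
      (A `&` [set x | (h x <= sup E - n.+1%:R^-1)%R])))
  (negligible_bigcup (fun n => _ : mu.-negligible
      (A `&` [set x | (sup E + n.+1%:R^-1 < h x)%R])))).
- move=> x [Ax /eqP]; rewrite neq_lt => /orP[] hx.
    have [n hn] := ltr_add_invr hx.
    by left; exists n => //; split => //=; rewrite lerBrDr ltW.
  have [n hn] := ltr_add_invr hx.
  by right; exists n.
- move=> n.
  have [r Er nr] : exists2 r, E r & (sup E - n.+1%:R^-1 < r)%R.
    by apply: sup_gt => //; rewrite ltrBlDr ltrDl.
  apply: negligibleS (Eneg r Er) => x [Ax /= hx]; split => //=.
  by rewrite (le_trans hx)// ltW.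
- move=> n; apply: nle; apply/eqP => En.
  have := ub_le_sup Eub (En : E (sup E + n.+1%:R^-1)%R).
  by rewrite gerDl leNgt invr_gt0 ltr0n.
Qed.

End Integration.

(** * Extremality and linear independence of the cell integrals *)

Section ExtremeIndependence.
Context {d : measure_display} {S : measurableType d} {R : realType}.
Implicit Types (mu nu : {measure set S -> \bar R}).

(** The measure with step density [w j] on [A j] is a sum of scaled truncations of [mu], so the
    closure properties of [L] keep it in [L]. *)
Lemma cone_weighted_truncation (L : set {measure set S -> \bar R})
    (L_cone : convex_cone L) (L_trunc : truncation_closed L)
    mu (Lmu : L mu) (J : Type) (A : J -> set S)
    (mA : forall j, measurable (A j)) (w : J -> {nonneg R}) (s : seq J) :
  exists nu, [/\ L nu,
    forall B, (nu B = \sum_(j <- s) (w j)%:num%:E * mu (B `&` A j))%E &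
    forall h, mu.-integrable setT h -> nu.-integrable setT h /\
      (\int[nu]_x h x =
       \sum_(j <- s) (w j)%:num%:E * \int[mu]_(x in A j) h x)%E].
Proof.
have [LZ LD] := L_cone.
elim: s => [|j s [nu [Lnu nuE nuI]]].
  (* The empty sum is [mu] scaled by zero, a scalar that the cone allows. *)
  exists (mscale (NngNum (lexx (0 : R))) mu); split; first exact: LZ.
    by move=> B; rewrite big_nil /= /mscale mul0e.
  move=> h /(integral_mscale (NngNum (lexx (0 : R))))[? ->].
  by rewrite big_nil mul0e.
pose nuj := mscale (w j) (mrestr mu (mA j)).
exists (measure_add nuj nu); split.
- by apply: LD => //; apply: LZ; exact: L_trunc.
- by move=> B; rewrite big_cons -nuE; exact: (measure_addE nuj nu B).
- move=> h ih; have [inu nuh] := nuI h ih.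
  have [ij jE] := integral_mrestr (mA j) ih.
  have [inuj nujE] := integral_mscale (w j) ij.
  split; last by rewrite integral_measure_add// big_cons nuh [X in (X + _)%E]nujE jE.
  have /integrableP[mh nuhoo] := inu; have /integrableP[_ nujhoo] := inuj.
  apply/integrableP; split => //; rewrite ge0_integral_measure_add//.
    by rewrite lte_add_pinfty.
  exact: measurableT_comp.
Qed.

(** With all measures as the cone and all weights 1, [cone_weighted_truncation] yields a measure
    that agrees with [mu] on measurable sets. *)
Lemma integral_fibers mu (J : finType) (phi : S -> J)
    (mphi : forall j, measurable (phi @^-1` [set j])) (h : S -> \bar R) :
  mu.-integrable setT h ->
  (\int[mu]_x h x = \sum_(j : J) \int[mu]_(x in phi @^-1` [set j]) h x)%E.
Proof.
move=> ih.
have [||nu [_ nuE /(_ _ ih)[_]]] := @cone_weighted_truncation setT _ _ mu Logic.I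
  J _ mphi (fun=> NngNum (@ler01 R)) (index_enum J) => //.
under eq_bigr do rewrite mul1e.
move=> <-; apply: eq_measure_integral => B mB _.
by rewrite nuE (measure_fibers mu mphi)//; under [RHS]eq_bigr do rewrite mul1e.
Qed.

Lemma extreme_fibers_indep (k : nat) (f : 'I_k -> S -> R) (C : set 'rV[R]_k)
    (L : set {measure set S -> \bar R}) (L_fin : L `<=` finite_measures)
    (L_cone : convex_cone L) (L_trunc : truncation_closed L)
    mu (mu_ex : extreme_points (L `&` moment_set f C) mu)
    (J : finType) (phi : S -> J)
    (mphi : forall j, measurable (phi @^-1` [set j])) (c : J -> R) :
  (forall l, \sum_j c j * \int[mu]_(x in phi @^-1` [set j]) f l x = 0) ->
  forall j, mu (phi @^-1` [set j]) != 0%E -> c j = 0.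
Proof.
have [[Lmu [mufin muf muC]] mu_extr] := mu_ex.
set A := fun j => phi @^-1` [set j].
set I := fun j l => \int[mu]_(x in A j) f l x.
have mA j : measurable (A j) by exact: mphi.
have IE j l : (\int[mu]_(x in A j) (f l x)%:E = (I j l)%:E)%E.
  rewrite fineK//; apply: (@integrable_fin_num _ _ _ mu (A j) _ (EFin \o f l)) => //.
  exact: integrableS (muf l).
(* Density [1 + e j] on cell [j] changes the moment vector by the sum of [e j * I j], so a linear
   relation [e] leaves it unchanged. *)
have perturb (e : J -> R) : (forall j, 0 <= 1 + e j) ->
    (forall l, \sum_j e j * I j l = 0) ->
    exists nu, (L `&` moment_set f C) nu /\
      forall B, (nu B = \sum_j (1 + e j)%:E * mu (B `&` A j))%E.
  move=> e0 eI.
  have [nu [Lnu nuE nuI]] := cone_weighted_truncation L_cone L_trunc Lmu mphi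
    (fun j => NngNum (e0 j)) (index_enum J).
  exists nu; split => //; split => //; split; first exact: L_fin.
    by move=> l; have [] := nuI _ (muf l).
  rewrite (_ : vintegral nu f = vintegral mu f)//; apply/rowP => l; rewrite !mxE.
  congr fine; have [_ ->] := nuI _ (muf l).
  rewrite (integral_fibers mphi (muf l)).
  under eq_bigr do rewrite IE /= -EFinM mulrDl mul1r.
  under [RHS]eq_bigr do rewrite IE.
  by rewrite !sumEFin big_split /= eI addr0.
move=> cI.
(* The added 1 keeps [M] positive even if [c] vanishes; since [|c j / M| <= 1], both densities
   [1 + c j / M] and [1 - c j / M] are nonnegative. *)
pose M := 1 + \sum_j `|c j|.
have M0 : 0 < M by rewrite ltr_pwDl// sumr_ge0.
have cM j : `|c j / M| <= 1.
  rewrite normrM normfV (gtr0_norm M0) ler_pdivrMr// mul1r.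
  by rewrite /M (bigD1 j)//= addrCA lerDl addr_ge0// sumr_ge0.
have eI l : \sum_j c j / M * I j l = 0.
  under eq_bigr do rewrite mulrAC.
  by rewrite -mulr_suml cI mul0r.
have [nu1 [K1 nu1E]] : exists nu, (L `&` moment_set f C) nu /\
      forall B, (nu B = \sum_j (1 + c j / M)%:E * mu (B `&` A j))%E.
  apply: perturb => // j; have := cM j; rewrite ler_norml => /andP[+ _].
  by rewrite -subr_ge0 opprK addrC.
have [nu2 [K2 nu2E]] : exists nu, (L `&` moment_set f C) nu /\
      forall B, (nu B = \sum_j (1 + - (c j / M))%:E * mu (B `&` A j))%E.
  apply: perturb => // [j|l]; last first.
    by under eq_bigr do rewrite mulNr; rewrite sumrN eI oppr0.
  by have := cM j; rewrite ler_norml subr_ge0 => /andP[].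
have muE B : measurable B -> (mu B = (fine (mu B))%:E)%E.
  by move=> mB; rewrite fineK// mufin.
have half : (1 - 2^-1 : R) = 2^-1 by rewrite [X in X - _]splitr mul1r addrK.
have half_lt1 : (2^-1 : R) < 1 by rewrite invf_lt1// ltr1n.
have eq12 : meas_eq nu1 nu2.
  apply: (mu_extr 2^-1) => // B mB.
  rewrite half nu1E nu2E (measure_fibers mu mphi mB).
  have mBA j : measurable (B `&` A j) by exact: measurableI.
  have sumE (e : J -> R) : (\sum_j (e j)%:E * mu (B `&` A j) =
      (\sum_j e j * fine (mu (B `&` A j)))%:E)%E.
    by rewrite -sumEFin; apply: eq_bigr => j _; rewrite EFinM -muE.
  under [RHS]eq_bigr do rewrite -[mu _]mul1e.
  rewrite !sumE -!EFinM -EFinD -mulrDr -big_split /=; congr (_%:E).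
  rewrite mulr_sumr; apply: eq_bigr => j _.
  by rewrite -mulrDl addrACA subrr addr0 mulrA -mulr2n mulVf ?pnatr_eq0.
move=> j muj.
(* On [A j] the two perturbations have masses [(1 + c j / M) * mu (A j)] and
   [(1 - c j / M) * mu (A j)]; cancelling the finite nonzero [mu (A j)] gives [c j = 0]. *)
have := eq12 (A j) (mphi j).
have AA (e : J -> R) :
    (\sum_i (e i)%:E * mu (A j `&` A i) = (e j)%:E * mu (A j))%E.
  rewrite (bigD1 j)//= setIid big1 ?adde0// => i ij.
  rewrite (_ : A j `&` A i = set0) ?measure0 ?mule0//.
  by apply/seteqP; split => // x [/= xj xi]; move/eqP: ij; apply; rewrite -xi.
rewrite nu1E nu2E !AA muE// -!EFinM => -[].
move: muj; rewrite muE// eqe => muj /(mulIf muj) /eqP.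
rewrite (inj_eq (addrI _)) -subr_eq0 opprK -mulr2n mulrn_eq0/=.
by rewrite mulf_eq0 invr_eq0 (gt_eqF M0) orbF => /eqP.
Qed.

End ExtremeIndependence.

(** * Partitions into atoms and null sets *)

Section AtomicFibers.
Context {d : measure_display} {S : measurableType d} {R : realType}.
Implicit Types (mu nu : {measure set S -> \bar R}).

Lemma measurable_neq (u v : S -> R) : measurable_fun setT u ->
  measurable_fun setT v -> measurable [set x | u x <> v x].
Proof.
move=> um vm.
rewrite (_ : [set x | _] = setT `&` (u \- v) @^-1` [set~ 0]).
  by apply: measurable_funB => //; exact: measurableC.
rewrite setTI; apply/seteqP; split => x /= uv; last first.
  by move=> E; apply: uv; rewrite E subrr.
by move/eqP; rewrite subr_eq0 => /eqP.
Qed.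

Lemma integral_null_neq mu (D : set S) (u v : S -> R) : measurable D ->
  measurable_fun setT u -> measurable_fun setT v ->
  mu (D `&` [set x | u x <> v x]) = 0%E ->
  (\int[mu]_(x in D) (u x)%:E = \int[mu]_(x in D) (v x)%:E)%E.
Proof.
move=> mD um vm uv0; apply: ae_eq_integral => //.
- exact/measurable_EFinP/measurable_funTS.
- exact/measurable_EFinP/measurable_funTS.
- exists (D `&` [set x | u x <> v x]); split => //.
    exact/measurableI/measurable_neq.
  by move=> x /= /not_implyP[Dx uvx]; split => //= uvE; apply: uvx; rewrite uvE.
Qed.

(** The exceptional sets of finitely many functions have a null union, which cannot exhaust [A]; any
    remaining point of [A] attains all the constants at once. *)
Lemma atom_representative mu (A : set S) (mA : measurable A) (muA : mu A != 0%E)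
    (atom : forall B, measurable B -> mu (A `&` B) = 0%E \/ mu (A `\` B) = 0%E)
    (K : finType) (F : K -> S -> R) (mF : forall l, measurable_fun setT (F l)) :
  exists2 s, A s & forall l, mu (A `&` [set x | F l x <> F l s]) = 0%E.
Proof.
have /choice[c c0] := fun l => atom_ae_constant mA muA atom (mF l).
suff [s As Fs] : exists2 s, A s & forall l, F l s = c l.
  by exists s => // l; rewrite Fs.
apply: contrapT => noS; move/eqP: muA; apply.
apply: measure_negligible => //.
(* The finite union is written as a countable one, with the empty set at every code that denotes no
   index. *)
pose N (n : nat) := if unpickle n is Some l then A `&` [set x | F l x <> c l] else set0.
apply: (@negligibleS _ _ _ mu (\bigcup_n N n)); last first.
  apply: negligible_bigcup => n; rewrite /N; case: unpickle => [l|]; last first.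
    exact: negligible_set0.
  apply/negligibleP; last exact: c0.
  apply: measurableI => //.
  exact: (measurable_neq (mF l) (measurable_cst (c l))).
move=> x Ax; apply: contrapT => Nx; apply: noS; exists x => // l.
apply: contrapT => Fx; apply: Nx; exists (pickle l) => //.
by rewrite /N pickleK.
Qed.

Definition heavy mu (J : finType) (phi : S -> J) : pred J :=
  [pred j | mu (phi @^-1` [set j]) != 0%E].

(** Cell [j0] is cut along [B]: the part in [B] gets the new label [None], the rest keeps [j0].
    Every heavy index stays heavy, and [None] is one more. *)
Lemma heavy_split mu (J : finType) (phi : S -> J)
    (mphi : forall j, measurable (phi @^-1` [set j])) j0 (B : set S) :
  measurable B ->
  mu (phi @^-1` [set j0] `&` B) != 0%E -> mu (phi @^-1` [set j0] `\` B) != 0%E ->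
  exists psi : S -> option J, (forall o, measurable (psi @^-1` [set o])) /\
    (#|heavy mu phi| < #|heavy mu psi|)%N.
Proof.
move=> mB muB muDB.
pose psi x := if (phi x == j0) && `[< B x >] then None else Some (phi x).
have psiN : psi @^-1` [set None] = phi @^-1` [set j0] `&` B.
  apply/seteqP; split => x /=; rewrite /psi.
    by case: ifPn => // /andP[/eqP-> /asboolP].
  by move=> [-> Bx]; rewrite eqxx asboolT.
have psi0 : psi @^-1` [set Some j0] = phi @^-1` [set j0] `\` B.
  apply/seteqP; split => x /=; rewrite /psi.
    case: ifPn => // + [phix]; rewrite phix eqxx /= => /asboolPn nBx.
    by split.
  by move=> [-> nBx]; rewrite asboolF// andbF.
have psiS j : j != j0 -> psi @^-1` [set Some j] = phi @^-1` [set j].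
  move=> jj0; apply/seteqP; split => x /=; rewrite /psi.
    by case: ifPn => // _ [].
  by move=> ->; rewrite (negbTE jj0).
exists psi; split.
  move=> [j|]; last by rewrite psiN; exact: measurableI.
  have [->|jj0] := eqVneq j j0; first by rewrite psi0; exact: measurableD.
  by rewrite psiS.
rewrite !cardE -(size_map Some).
apply: (@uniq_leq_size _ (None :: map Some (enum (heavy mu phi)))).
  rewrite /= map_inj_uniq ?enum_uniq ?andbT; last by move=> ? ? [].
  by apply/negP => /mapP[].
move=> o; rewrite inE mem_enum inE => /predU1P[->|/mapP[j + ->]].
  by rewrite psiN.
rewrite mem_enum inE => muj.
by have [->|jj0] := eqVneq j j0; [rewrite psi0|rewrite psiS].
Qed.

Lemma atomic_partition mu (k : nat) :
  (forall (J : finType) (phi : S -> J),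
    (forall j, measurable (phi @^-1` [set j])) -> (#|heavy mu phi| <= k)%N) ->
  exists (J : finType) (phi : S -> J),
    (forall j, measurable (phi @^-1` [set j])) /\
    forall j, mu (phi @^-1` [set j]) != 0%E -> forall B, measurable B ->
      mu (phi @^-1` [set j] `&` B) = 0%E \/ mu (phi @^-1` [set j] `\` B) = 0%E.
Proof.
move=> heavyk.
(* [Q] holds at the numbers of heavy cells attained over all finite index types. It is inhabited by
   the one-cell partition and bounded by [k]; at the maximum, [heavy_split] forbids any further
   cut. *)
pose Q n := `[< exists (J : finType) (phi : S -> J),
  (forall j, measurable (phi @^-1` [set j])) /\ #|heavy mu phi| = n >].
have exQ : exists n, Q n.
  exists #|heavy mu (fun=> tt)|; apply/asboolP; exists unit, (fun=> tt).
  by split => // -[]; rewrite (_ : _ @^-1` _ = setT)//; apply/seteqP; split.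
have ubQ n : Q n -> (n <= k)%N.
  by move=> /asboolP[J [phi [mphi <-]]]; exact: heavyk.
have [n /asboolP[J [phi [mphi phin]]] nmax] := ex_maxnP exQ ubQ.
exists J, phi; split => // j muj B mB.
have [->|muB] := eqVneq (mu (phi @^-1` [set j] `&` B)) 0%E; first by left.
have [->|muDB] := eqVneq (mu (phi @^-1` [set j] `\` B)) 0%E; first by right.
have [psi [mpsi]] := heavy_split mphi mB muB muDB.
rewrite phin ltnNge nmax//; apply/asboolP.
by exists (option J), psi.
Qed.

End AtomicFibers.

(** * Moving the mass of each cell to one point *)

Section Collapse.
Context {d : measure_display} {S : measurableType d} {R : realType}.
Implicit Types (mu nu : {measure set S -> \bar R}).

Lemma integral_atom mu (A : set S) (h : S -> R) (s : S) : measurable A ->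
  measurable_fun setT h -> mu (A `&` [set x | h x <> h s]) = 0%E ->
  \int[mu]_(x in A) h x = fine (mu A) * h s.
Proof.
move=> mA mh h0; rewrite mulrC -Rintegral_cst//; congr fine.
exact: (integral_null_neq mA mh (measurable_cst (h s)) h0).
Qed.

(** The new measure is the image of [mu] under [T], which sends each cell to its chosen point. Its
    integral of [h] is the [mu]-integral of [h \o T], and [h \o T] equals [h] almost everywhere. *)
Lemma collapse_fibers mu (mufin : fin_num_fun mu) (J : finType) (phi : S -> J)
    (mphi : forall j, measurable (phi @^-1` [set j])) (s : J -> S) :
  exists mu' : {measure set S -> \bar R},
    (forall B, measurable B ->
      (mu' B = \sum_j mu (phi @^-1` [set j]) * \d_(s j) B)%E) /\
    forall h : S -> R, measurable_fun setT h ->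
      (forall j, mu (phi @^-1` [set j] `&` [set x | h x <> h (s j)]) = 0%E) ->
      mu'.-integrable setT (EFin \o h) /\
      (\int[mu']_x (h x)%:E = \int[mu]_x (h x)%:E)%E.
Proof.
pose T := s \o phi.
have mT : measurable_fun setT T.
  move=> _ B mB; rewrite setTI.
  rewrite (_ : T @^-1` B = \bigcup_(j in [set j | B (s j)]) phi @^-1` [set j]).
    by apply: fin_bigcup_measurable => //; exact: finite_finset.
  apply/seteqP; split => x; first by move=> BTx; exists (phi x).
  by move=> [j /= Bj xj]; rewrite /T /= xj.
(* [pose] abstracts over the measurability proof needed by the measure instance. *)
pose muT : {measure set S -> \bar R} := pushforward mu T.
pose mu' := muT mT.
exists mu'; split.
  move=> B mB; rewrite /mu' /= /pushforward.
  have mTB : measurable (T @^-1` B) by rewrite -[X in measurable X]setTI; apply: (mT).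
  rewrite (measure_fibers mu mphi mTB); apply: eq_bigr => j _.
  rewrite diracE; have [sB|sB] := boolP (s j \in B).
    rewrite mule1; congr (mu _); apply/seteqP; split => x /=; first by case.
    by move=> xj; split => //; rewrite /T /= xj; exact/set_mem.
  rewrite mule0 (_ : _ `&` _ = set0) ?measure0//.
  apply/seteqP; split => // x [/= Bx xj]; move: sB; rewrite notin_setE; apply.
  by rewrite -xj.
move=> h mh hs.
have mhT : measurable_fun setT (h \o T) by exact: measurableT_comp.
(* [h \o T] takes finitely many values, hence is bounded, and [mu] is finite: integrability of [h]
   is obtained here, not assumed. *)
have ihT : mu.-integrable setT (EFin \o (h \o T)).
  apply: measurable_bounded_integrable => //.
    by rewrite ltey_eq mufin.
  exists (\sum_j `|h (s j)|); split; first exact: num_real.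
  move=> M /ltW hM x _ /=; apply: le_trans hM.
  by rewrite (bigD1 (phi x))//= lerDl sumr_ge0.
have mEh : measurable_fun setT (EFin \o h) by exact/measurable_EFinP.
split; first exact: (integrable_pushforward mT mEh ihT measurableT).
rewrite (integral_pushforward mT mEh ihT measurableT) preimage_setT.
apply: integral_null_neq => //; rewrite setTI.
rewrite (measure_fibers mu mphi (measurable_neq mhT mh)) big1// => j _.
apply: measure_negligible.
  exact/measurableI/mphi/measurable_neq.
apply: (@negligibleS _ _ _ mu (phi @^-1` [set j] `&` [set x | h x <> h (s j)])).
  by move=> x [/= hx xj]; split => //= hxj; apply: hx; rewrite /T /= xj.
apply/negligibleP; last exact: hs.
exact: measurableI (mphi j) (measurable_neq mh (measurable_cst (h (s j)))).
Qed.

(** A combination of [m <= k] Dirac measures is padded to length [k] with zero weights at the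
    default [point]. *)
Lemma Delta_indep_Delta (k : nat) (f : 'I_k -> S -> R) :
  Delta_indep f `<=` Delta k.
Proof.
move=> nu [m [a [s [mk a0 _ nuE]]]].
pose a' (i : nat) := if insub i is Some j then a j else 0.
pose s' (i : nat) := if insub i is Some j then s j else point.
exists a', s'; split.
  by move=> i; rewrite /a'; case: insub => [j|//]; exact/ltW/a0.
move=> B mB; rewrite nuE//.
pose F i := ((a' i)%:E * \d_(s' i) B)%E.
rewrite (eq_bigr (fun i : 'I_m => F i)); last first.
  by move=> i _; rewrite /F /a' /s' valK.
rewrite (big_ord_widen _ F mk) [RHS](bigID (fun i : 'I_k => (i < m)%N))/=.
rewrite [X in (_ + X)%E]big1 ?adde0// => i im.
by rewrite /a' insubN// mul0e.
Qed.

End Collapse.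

(** * Free families indexed by the heavy cells *)

Section Free.
Context {d : measure_display} {S : measurableType d} {R : realType}.
Context {k : nat} {f : 'I_k -> S -> R} {C : set 'rV[R]_k}.
Context {L : set {measure set S -> \bar R}} (L_fin : L `<=` finite_measures).
Context (L_cone : convex_cone L) (L_trunc : truncation_closed L).
Context {mu : {measure set S -> \bar R}}.
Context (mu_ex : extreme_points (L `&` moment_set f C) mu).

(** The factorisation [a j * X j] serves two uses: [a = 1] with the integral vectors bounds the
    number of heavy cells, and [a] the mass with [X] the value of [f] at a point gives independence
    in [Delta_indep]. *)
Lemma heavy_free (J : finType) (phi : S -> J)
    (mphi : forall j, measurable (phi @^-1` [set j]))
    (a : J -> R) (X : J -> 'rV[R]_k) :
  (forall j, heavy mu phi j -> a j != 0) ->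
  (forall j l, heavy mu phi j ->
    \int[mu]_(x in phi @^-1` [set j]) f l x = a j * X j ord0 l) ->
  free [seq X (enum_val i) | i <- enum 'I_#|heavy mu phi|].
Proof.
move=> a0 aX.
pose n := #|heavy mu phi|.
pose ev (i : 'I_n) : J := enum_val i.
have hev i : heavy mu phi (ev i) by exact: (@enum_valP _ (heavy mu phi) i).
apply/(@freeP _ _ n [tuple X (ev i) | i < n]) => c cX i.
(* The relation [c] among the heavy [X] becomes one among the cell integrals: divide by [a j] and
   extend by zero. As [ev] is injective, the sum has at most one term. *)
pose e j := \sum_(i0 | ev i0 == j) c i0 / a j.
have ee i0 : e (ev i0) = c i0 / a (ev i0).
  rewrite /e (big_pred1 i0)// => i1 /=.
  by rewrite (inj_eq enum_val_inj).
suff e0 j : mu (phi @^-1` [set j]) != 0%E -> e j = 0.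
  have /eqP := e0 _ (hev i).
  by rewrite ee mulf_eq0 invr_eq0 (negbTE (a0 _ (hev i))) orbF => /eqP.
apply: (extreme_fibers_indep L_fin L_cone L_trunc mu_ex mphi) => l.
under eq_bigr do rewrite /e mulr_suml.
rewrite (exchange_big_dep predT)//=.
transitivity ((\sum_i0 c i0 *: X (ev i0)) ord0 l).
  rewrite summxE; apply: eq_bigr => i0 _.
  rewrite (big_pred1 (ev i0)) ; last by move=> ? /=; rewrite eq_sym.
  rewrite mxE aX//.
  by rewrite mulrA divfK// a0.
have -> : \sum_i0 c i0 *: X (ev i0) = 0.
  rewrite -[RHS]cX; apply: eq_bigr => i0 _.
  by rewrite -tnth_nth tnth_mktuple.
by rewrite mxE.
Qed.

Lemma heavy_card (J : finType) (phi : S -> J)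
    (mphi : forall j, measurable (phi @^-1` [set j])) :
  (#|heavy mu phi| <= k)%N.
Proof.
pose X j := \row_l \int[mu]_(x in phi @^-1` [set j]) f l x.
have /eqP : free [seq X (enum_val i) | i <- enum 'I_#|heavy mu phi|].
  apply: (heavy_free mphi (a := fun=> 1)) => [j _|j l _]; first exact: oner_neq0.
  by rewrite mul1r mxE.
rewrite size_map size_enum_ord => <-.
apply: leq_trans (dimvS (subvf _)) _.
by rewrite dimvf /dim /= mul1n.
Qed.

End Free.

(** * Construction of the discrete measure *)

Unset Implicit Arguments.
Set Strict Implicit.

Theorem corollary4 (R : realType) (d : measure_display) (S : measurableType d)
    (k : nat) (hk : (0 < k)%N)
    (f : 'I_k -> S -> R) (mf : forall j, measurable_fun setT (f j))
    (C : set 'rV[R]_k)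
    (L : set {measure set S -> \bar R})
    (L_fin : L `<=` finite_measures)
    (L_sat : meas_saturated L)
    (L_cone : convex_cone L)
    (L_trunc : truncation_closed L)
    (g : S -> R) (mg : measurable_fun setT g)
    (g_int : forall nu, (L `&` moment_set f C) nu -> integral_exists nu g)
    (mu : {measure set S -> \bar R})
    (mu_ex : extreme_points (L `&` moment_set f C) mu) :
  (exists mu' : {measure set S -> \bar R},
    [/\ (Delta_indep f `&` moment_set f C) mu',
        vintegral mu' f = vintegral mu f,
        (\int[mu']_x (g x)%:E = \int[mu]_x (g x)%:E)%E &
        Delta_indep f `<=` L ->
          (Delta_indep f `&` (L `&` moment_set f C)) mu'])
  /\
  (exists mu' : {measure set S -> \bar R},
    [/\ (Delta k `&` moment_set f C) mu',
        vintegral mu' f = vintegral mu f,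
        (\int[mu']_x (g x)%:E = \int[mu]_x (g x)%:E)%E &
        Delta k `<=` L ->
          (Delta k `&` (L `&` moment_set f C)) mu']).

Proof.
have [[Lmu [mufin muf muC]] _] := mu_ex.
have [J [phi [mphi atom]]] := atomic_partition (fun J phi mphi =>
  heavy_card L_fin L_cone L_trunc mu_ex (phi := phi) mphi).
(* The [f l] and [g] form a single finite family, so that one point per cell serves all of them. *)
pose F (o : option 'I_k) : S -> R := if o is Some l then f l else g.
have mF o : measurable_fun setT (F o) by case: o.
have /choice[s sF] : forall j, exists s0, forall o,
    mu (phi @^-1` [set j] `&` [set x | F o x <> F o s0]) = 0%E.
  move=> j; have [muj|muj] := eqVneq (mu (phi @^-1` [set j])) 0%E; last first.
    by have [s0 _ s0F] := atom_representative (mphi j) muj (atom j muj) mF; exists s0.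
  (* On a null cell any point will do. *)
  exists point => o; apply: measure_negligible.
    exact: measurableI (mphi j) (measurable_neq (mF o) (measurable_cst _)).
  by apply: (negligibleS (@subIsetl _ _ _)); apply/negligibleP.
have [mu' [mu'E mu'int]] := collapse_fibers mufin mphi s.
have mu'f l := mu'int (f l) (mf l) (fun j => sF j (Some l)).
have [_ mu'g] := mu'int g mg (fun j => sF j None).
have vE : vintegral mu' f = vintegral mu f.
  by apply/rowP => l; rewrite !mxE; congr fine; have [] := mu'f l.
have mu'M : moment_set f C mu'.
  split; last by rewrite vE.
  - move=> A mA; rewrite mu'E// sum_fin_num; apply/allP => _ /mapP[j _ ->].
    by rewrite inE fin_numM// ?mufin// diracE.
  - by move=> l; have [] := mu'f l.
have finE j : (mu (phi @^-1` [set j]) = (fine (mu (phi @^-1` [set j])))%:E)%E.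
  by rewrite fineK// mufin.
have a_neq0 j : heavy mu phi j -> fine (mu (phi @^-1` [set j])) != 0.
  by rewrite /heavy/= finE eqe.
have mu'D : Delta_indep f mu'.
  exists #|heavy mu phi|,
    (fun i => fine (mu (phi @^-1` [set (enum_val i)]))), (fun i => s (enum_val i)).
  split.
  - exact: (heavy_card L_fin L_cone L_trunc mu_ex mphi).
  - move=> i; rewrite lt0r fine_ge0 ?measure_ge0// andbT a_neq0//.
    exact: (@enum_valP _ (heavy mu phi) i).
  (* On each cell the integral of [f] is the mass times [f (s j)], so independence passes to the
     vectors [f (s j)] of the heavy cells. *)
  - apply: (heavy_free L_fin L_cone L_trunc mu_ex mphi (X := fun j => vec f (s j)) a_neq0).
    move=> j l _; rewrite mxE; exact: integral_atom (mphi j) (mf l) (sF j (Some l)).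
  (* Null cells contribute zero weight, which leaves the sum over heavy cells. *)
  - move=> B mB; rewrite mu'E// (bigID (heavy mu phi))/= [X in (_ + X)%E]big1.
      rewrite adde0 -(@big_enum_val _ _ _ _ (heavy mu phi)
        (fun j => (fine (mu (phi @^-1` [set j])))%:E * \d_(s j) B)%E).
      by apply: eq_bigr => j _; rewrite -finE.
    by move=> j /negPn/eqP ->; rewrite mul0e.
have mu'Dk : Delta k mu' by exact: Delta_indep_Delta mu'D.
by split; exists mu'; split => //; move=> DL; do 2 split => //; exact: DL.
Qed.
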